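(* Consider the linear time-invariant plant $x_{t+1}=Ax_t+B_uu_t+B_ww_t$, $t\ge 0$, with $A$ nonsingular, $(A,B_u)$ stabilizable, $Q\succeq0$, $R\succ 0$ and $(A,Q)$ detectable, and let $P,H,K_x,K_w,K_v,\hat A$ be as defined in the context. Let $w\in\ell_2$ be any given (deterministic) disturbance sequence. Then the optimal noncausal controller is given by $$u_t^{nc}=-K_xx_t-K_ww_t-K_vv^{nc}_{t+1},$$ where $v^{nc}$, the solution of the anticausal dynamics $v^{nc}_t=\hat A^\top(v^{nc}_{t+1}+PB_ww_t)$, $v^{nc}_\infty=0$, can be expressed as $$v^{nc}_{t+1}=\sum_{j=t+1}^{\infty}\big[\hat A^\top\big]^{j-t}PB_ww_j .$$ Moreover, let $u_t^p$ denote the optimal finite preview controller with $p<\infty$ steps of preview, $$u_t^p=-K_xx_t-K_ww_t-K_vv^p_{t+1},\qquad v^p_{t+1}=\sum_{j=t+1}^{t+p}\big[\hat A^\top\big]^{j-t}PB_ww_j .$$ Then $\|u_t^{nc}-u_t^p\|_2\to 0$ uniformly in $t$ as $p\to\infty$, where $u_t^{nc}$ and $u_t^p$ are the control commands generated at time $t$ when each controller is run in closed loop with the plant (each using its own closed-loop state $x_t$), from the same initial condition $x_0$ and with the same disturbance $w$.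
   Context: Here $x_t\in\mathbb{R}^{n_x}$, $u_t\in\mathbb{R}^{n_u}$, $w_t\in\mathbb{R}^{n_w}$ are the state, input and disturbance; the real matrices $A,B_u,B_w,Q,R$ have compatible dimensions with $Q,R$ symmetric. $\ell_2$ is the space of square-summable sequences $(w_t)_{t\ge 0}$. Under the stated assumptions let $P\succeq 0$ be the unique stabilizing solution of the discrete-time algebraic Riccati equation $$0=P-A^\top PA-Q+A^\top PB_uH^{-1}B_u^\top PA,\qquad H:=R+B_u^\top PB_u\succ 0,$$ where stabilizing means that $\hat A:=A-B_uK_x$ is Schur (spectral radius $<1$), with $$K_x:=H^{-1}B_u^\top PA,\qquad K_w:=H^{-1}B_u^\top PB_w,\qquad K_v:=H^{-1}B_u^\top .$$ The optimal noncausal controller is the sequence of deterministic policies $u_t=k_t(i_t)$, using the full-preview information $i_t=\{x_0,\ldots,x_t,w_0,w_1,\ldots\}$, that minimizes $\sum_{t=0}^\infty\big(x_t^\top Qx_t+u_t^\top Ru_t\big)$ over all such policies that stabilize the plant (keep the state uniformly bounded). The optimal finite preview controller is the policy that minimizes the expected average per-step cost $\mathbb{E}\big[\lim_{T\to\infty}\frac1T\sum_{t=0}^{T-1}(x_t^\top Qx_t+u_t^\top Ru_t)\mid i_0\big]$ for IID disturbances with zero mean and identity covariance, over stabilizing policies using $i_t=\{x_0,\ldots,x_t,w_0,\ldots,w_{t+p}\}$; it is given by the formula for $u_t^p$ in the claim, which is here applied to the given deterministic $w$. *)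

(* Defs.v *)
From HB Require Import structures.
From mathcomp Require Import all_boot all_order all_algebra.
From mathcomp Require Import all_classical all_reals all_analysis.
From mathcomp Require Import complex.
Set Implicit Arguments.
Unset Strict Implicit.
Unset Printing Implicit Defensive.
Import Order.TTheory GRing.Theory Num.Theory.
Import numFieldNormedType.Exports.
Local Open Scope classical_set_scope.
Local Open Scope ring_scope.

Definition norm2 (F : realType) n (v : 'cV[F]_n) : F :=
  Num.sqrt (\sum_(i < n) v i 0 ^+ 2).

Definition qform (F : realType) n (M : 'M[F]_n) (v : 'cV[F]_n) : F :=
  (v^T *m M *m v) 0 0.

Definition psd (F : realType) n (M : 'M[F]_n) : Prop :=
  M^T = M /\ forall v : 'cV[F]_n, 0 <= qform M v.

Definition pd (F : realType) n (M : 'M[F]_n) : Prop :=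
  M^T = M /\ forall v : 'cV[F]_n, v != 0 -> 0 < qform M v.

(* Spectral radius < 1: the eigenvalues are the complex ones. *)
Definition schur (F : realType) n (M : 'M[F]_n) : Prop :=
  forall z : F[i], eigenvalue (map_mx (@real_complex F) M) z -> `|z| < 1.

Definition stabilizable (F : realType) nx nu
    (A : 'M[F]_nx) (B : 'M[F]_(nx, nu)) : Prop :=
  exists K : 'M[F]_(nu, nx), schur (A - B *m K).

Definition detectable (F : realType) nx ny
    (A : 'M[F]_nx) (C : 'M[F]_(ny, nx)) : Prop :=
  exists L : 'M[F]_(nx, ny), schur (A - L *m C).

Definition ell2 (F : realType) n (w : nat -> 'cV[F]_n) : Prop :=
  cvgn (series (fun t => norm2 (w t) ^+ 2)).

Section Riccati.
Context (F : realType) (nx nu nw : nat).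
Variables (A : 'M[F]_nx) (Bu : 'M[F]_(nx, nu)) (Bw : 'M[F]_(nx, nw)).
Variables (Q : 'M[F]_nx) (R : 'M[F]_nu) (P : 'M[F]_nx).

Definition Hmx : 'M[F]_nu := R + Bu^T *m P *m Bu.
Definition Kx : 'M[F]_(nu, nx) := invmx Hmx *m Bu^T *m P *m A.
Definition Kw : 'M[F]_(nu, nw) := invmx Hmx *m Bu^T *m P *m Bw.
Definition Kv : 'M[F]_(nu, nx) := invmx Hmx *m Bu^T.
Definition Ahat : 'M[F]_nx := A - Bu *m Kx.

Definition stabilizing_dare_solution : Prop :=
  [/\ psd P, pd Hmx,
      0 = P - A^T *m P *m A - Q
          + A^T *m P *m Bu *m invmx Hmx *m Bu^T *m P *m A
    & schur Ahat].

End Riccati.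

(* A full-preview policy k: the input at time t is k t [x_0; ...; x_t] w. *)
Definition policy (F : realType) (nx nu nw : nat) : Type :=
  forall t : nat, t.+1.-tuple 'cV[F]_nx -> (nat -> 'cV[F]_nw) -> 'cV[F]_nu.

Section ClosedLoop.
Context (F : realType) (nx nu nw : nat).
Variables (A : 'M[F]_nx) (Bu : 'M[F]_(nx, nu)) (Bw : 'M[F]_(nx, nw)).
Variables (Q : 'M[F]_nx) (R : 'M[F]_nu).
Implicit Types (k : policy F nx nu nw) (w : nat -> 'cV[F]_nw).

(* [x_0; ...; x_t] along the closed loop; x_t is the entry of index ord_max. *)
Fixpoint history k w (x0 : 'cV[F]_nx) (t : nat) : t.+1.-tuple 'cV[F]_nx :=
  match t with
  | 0 => [tuple x0]
  | s.+1 =>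
      let xs := history k w x0 s in
      [tuple of rcons xs (A *m tnth xs ord_max + Bu *m k s xs w + Bw *m w s)]
  end.

Definition state k w x0 (t : nat) : 'cV[F]_nx :=
  tnth (history k w x0 t) ord_max.

Definition command k w x0 (t : nat) : 'cV[F]_nu := k t (history k w x0 t) w.

Definition stabilizing k w : Prop :=
  forall x0 : 'cV[F]_nx, exists M : F, forall t, norm2 (state k w x0 t) <= M.

(* Extended-real valued; for Q, R positive semidefinite all terms are >= 0. *)
Definition cost k w x0 : \bar F :=
  (\sum_(0 <= t <oo)
     (qform Q (state k w x0 t) + qform R (command k w x0 t))%:E)%E.

Definition noncausal_optimal w k : Prop :=
  stabilizing k w /\
  forall k', stabilizing k' w -> forall x0, (cost k w x0 <= cost k' w x0)%E.

End ClosedLoop.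

Section Controllers.
Context (F : realType) (nx nu nw : nat).
Variables (A : 'M[F]_nx) (Bu : 'M[F]_(nx, nu)) (Bw : 'M[F]_(nx, nw)).
Variables (R : 'M[F]_nu) (P : 'M[F]_nx).
Implicit Types (w : nat -> 'cV[F]_nw) (v : nat -> 'cV[F]_nx).

Definition anticausal_solution w v : Prop :=
  (forall t, v t = (Ahat A Bu R P)^T *m (v t.+1 + P *m Bw *m w t)) /\
  v t @[t --> \oo] --> (0 : 'cV[F]_nx).

(* v^nc; the value 0 is used only if there is no solution. *)
Definition vnc w : nat -> 'cV[F]_nx :=
  xget (fun=> 0) [set v | anticausal_solution w v].

(* The summand of index j in the formulas for v_{t+1}. *)
Definition preview_term w (t j : nat) : 'cV[F]_nx :=
  (Ahat A Bu R P)^T ^+ (j - t) *m P *m Bw *m w j.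

(* vnext w t stands for v_{t+1}. *)
Definition preview_policy (vnext : (nat -> 'cV[F]_nw) -> nat -> 'cV[F]_nx) :
    policy F nx nu nw :=
  fun t xs w => - (Kx A Bu R P *m tnth xs ord_max)
                - Kw Bu Bw R P *m w t - Kv Bu R P *m vnext w t.

Definition noncausal_policy : policy F nx nu nw :=
  preview_policy (fun w t => vnc w t.+1).

Definition finite_preview_policy (p : nat) : policy F nx nu nw :=
  preview_policy
    (fun w t => \sum_(t.+1 <= j < (t + p).+1) preview_term w t j).

End Controllers.

(* Main.v *)
(**
Since Ahat is Schur, some norm N satisfies N (Ahat x) <= r N x with r < 1, and
likewise for its transpose. The geometric decay of the powers behind this is
obtained from the Cayley-Hamilton theorem over the complex numbers. Hence
forward and anticausal recursions driven by a square-summable sequence have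
square-summable, in particular vanishing, solutions.

Put V_t(x) = x^T P x + 2 v_t^T x with v = v^nc. By the Riccati equation, along
every trajectory the stage cost plus V_(t+1)(x_(t+1)) - V_t(x_t) equals
|u_t - u*_t(x_t)|_H^2 + d_t, where u*_t is the noncausal feedback and d_t depends
only on w and v. If a policy has finite cost, then Q x and u are square-summable,
so by detectability x is too and V_t(x_t) vanishes. Its cost therefore exceeds
the cost of the noncausal policy by the sum of the |u_t - u*_t(x_t)|_H^2, which
yields both optimality and uniqueness of the commands.

For the preview controllers, v^nc_(t+1) - v^p_(t+1) = (Ahat^T)^p v^nc_(t+p+1) is
O(r^p) uniformly in t, and the difference of the two closed-loop states is driven
through Ahat by this error.
*)

Require Import Defs.
From HB Require Import structures.
From mathcomp Require Import all_boot all_order all_algebra.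
From mathcomp Require Import all_classical all_reals all_analysis.
From mathcomp Require Import complex ring lra.
Set Implicit Arguments.
Unset Strict Implicit.
Unset Printing Implicit Defensive.
Import Order.TTheory GRing.Theory Num.Theory.
Import numFieldNormedType.Exports.
Local Open Scope classical_set_scope.
Local Open Scope ring_scope.

(** * Powers of Schur matrices *)

Section SchurPowers.
Context (F : realType).

Lemma mx_entry_le_norm m n (M : 'M[F]_(m, n)) i j : `|M i j| <= `|M|.
Proof.
by rewrite [leRHS]/Num.norm/= mx_normrE; apply/bigmax_geP; right; exists (i, j).
Qed.

Lemma mx_norm_le_entries m n (M : 'M[F]_(m, n)) c :
  0 <= c -> (forall i j, `|M i j| <= c) -> `|M| <= c.
Proof.
move=> c0 Mc; rewrite [leLHS]/Num.norm/= mx_normrE; apply/bigmax_leP.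
by split=> // -[i j] _; exact: Mc.
Qed.

(** The norm [|M|] is the largest entry and is not submultiplicative; this sum bounds the operator
    norm that it induces. *)
Definition mx_opnorm m n (M : 'M[F]_(m, n)) : F := \sum_i \sum_j `|M i j|.

Lemma mx_opnorm_ge0 m n (M : 'M[F]_(m, n)) : 0 <= mx_opnorm M.
Proof. by do 2 (apply: sumr_ge0 => ? _). Qed.

Lemma norm_mulmx m n p (M : 'M[F]_(m, n)) (X : 'M[F]_(n, p)) :
  `|M *m X| <= mx_opnorm M * `|X|.
Proof.
apply: mx_norm_le_entries => [|i k]; first by rewrite mulr_ge0 ?mx_opnorm_ge0.
rewrite mxE (le_trans (ler_norm_sum _ _ _))// /mx_opnorm (bigD1 i)//= mulrDl.
rewrite ler_wpDr ?mulr_ge0 ?sumr_ge0// => [i' _|]; first exact: sumr_ge0.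
rewrite mulr_suml; apply: ler_sum => j _; rewrite normrM ler_wpM2l//.
exact: mx_entry_le_norm.
Qed.

Lemma recurrence_geometric_bound (a : nat -> F) z r C :
  0 <= z < r -> (forall k, a k.+1 <= z * a k + C * r ^+ k) ->
  exists C', forall k, a k <= C' * r ^+ k.
Proof.
(* The summand [|C| / (r - z)] is the solution [c] of [z * c + |C| = r * c], so the forcing is
   absorbed at each step. *)
move=> /andP[z0 zr] aS; exists (`|a 0%N| + `|C| / (r - z)); elim=> [|k IH].
  by rewrite expr0 mulr1 ler_wpDr ?ler_norm// divr_ge0// subr_ge0 ltW.
apply: (le_trans (aS k)).
apply: (@le_trans _ _ (z * ((`|a 0%N| + `|C| / (r - z)) * r ^+ k)
                       + `|C| * r ^+ k)).
  by rewrite lerD ?ler_wpM2l ?ler_wpM2r ?ler_norm// exprn_ge0// (le_trans z0) ?ltW.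
rewrite mulrA -mulrDl exprSr mulrA [leRHS]mulrAC ler_wpM2r//.
  by rewrite exprn_ge0// (le_trans z0) ?ltW.
rewrite -subr_ge0.
have -> : (`|a 0%N| + `|C| / (r - z)) * r - (z * (`|a 0%N| + `|C| / (r - z)) + `|C|)
   = `|a 0%N| * (r - z).
  by field; rewrite subr_eq0 gt_eqF.
by rewrite mulr_ge0// subr_ge0 ltW.
Qed.

Local Notation normc := (@Normc.normc F).

(** The right factor [Y] is there to absorb factors [M - z] of the characteristic polynomial. *)
Definition geometric_powers n p (r : F) (M : 'M[F[i]]_n) (Y : 'M[F[i]]_(n, p)) :=
  exists C, forall k i j, normc ((M ^+ k *m Y) i j) <= C * r ^+ k.

(* The sequence M^k Y satisfies M^(k+1) Y = z M^k Y + M^k (M - z) Y, so one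
   factor of the characteristic polynomial can be removed at a time. *)
Lemma geometric_powers_root n p (r : F) (M : 'M[F[i]]_n) (Y : 'M[F[i]]_(n, p)) z :
  normc z < r -> geometric_powers r M ((M - z%:M) *m Y) ->
  geometric_powers r M Y.
Proof.
move=> zr [C MC].
have z0 : 0 <= normc z by case: z {zr MC} => a b; exact: sqrtr_ge0.
have : forall i j, exists C', forall k, normc ((M ^+ k *m Y) i j) <= C' * r ^+ k.
  move=> i j; apply: (@recurrence_geometric_bound _ (normc z) r C).
    by rewrite z0.
  move=> k; have -> : M ^+ k.+1 *m Y = z *: (M ^+ k *m Y) + M ^+ k *m ((M - z%:M) *m Y).
    rewrite mulmxBl mulmxBr exprSr -mulmxE mulmxA mul_scalar_mx -scalemxAr.
    by rewrite addrC subrK.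
  have normD (x y : F[i]) : normc (x + y) <= normc x + normc y := le_normcD x y.
  rewrite mxE (le_trans (normD _ _))// mxE Normc.normcM lerD2l; exact: MC.
move=> CY.
have [ij|f fP] := @boolp.choice _ _ (fun ij c => forall k,
    normc ((M ^+ k *m Y) ij.1 ij.2) <= c * r ^+ k); first exact: CY.
exists (\sum_ij `|f ij|) => k i j; rewrite (le_trans (fP (i, j) k))//.
rewrite ler_wpM2r// ?exprn_ge0// ?(le_trans z0 (ltW zr))//.
by rewrite (bigD1 (i, j))//= ler_wpDr ?ler_norm// sumr_ge0.
Qed.

Lemma schur_geometric_powers n (M : 'M[F]_n) : schur M ->
  exists C r, [/\ 0 <= r < 1, 0 <= C & forall k, `|M ^+ k| <= C * r ^+ k].
Proof.
case: n M => [|n] M M_schur.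
  exists 0, 0; split=> [|//|k]; first by rewrite lexx ltr01.
  by rewrite mul0r mx_norm_le_entries// => -[].
pose MC := map_mx (@real_complex F) M.
have [s char_MC] := closed_field_poly_normal (char_poly MC).
rewrite (monicP (char_poly_monic _)) scale1r in char_MC.
have s_lt1 z : z \in s -> normc z < 1.
  move=> zs; have : eigenvalue MC z.
    by rewrite eigenvalue_root_char char_MC root_prod_XsubC.
  by move/M_schur; rewrite -ltcR.
(* Midpoint between the spectral radius and 1, so that every root lies strictly below [r]. *)
pose r := (1 + \big[Num.max/0]_(z <- s) normc z) / 2.
have smax_ge0 : 0 <= \big[Num.max/0]_(z <- s) normc z.
  by apply: bigmax_ge_id.
have smax_lt1 : \big[Num.max/0]_(z <- s) normc z < 1.
  by rewrite big_seq; apply: bigmax_lt.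
have s_ltr z : z \in s -> normc z < r.
  move=> zs; have : normc z <= \big[Num.max/0]_(z <- s) normc z.
    exact: le_bigmax_seq.
  rewrite /r; lra.
have [C MC_le] : geometric_powers r MC 1%:M.
  have : horner_mx MC (\prod_(z <- s) ('X - z%:P)) *m 1%:M = 0.
    by rewrite -char_MC Cayley_Hamilton mul0mx.
  (* With [1%:M] generalized to [Y], the induction on the roots can use its hypothesis at
     [(M - z%:M) *m Y]; once no root is left, [Y = 0]. *)
  move: s_ltr; rewrite -/r; move: (1%:M) r => Y r.
  elim: s Y {char_MC s_lt1 smax_ge0 smax_lt1} => [|z s IH] Y s_ltr.
    rewrite big_nil rmorph1 mul1mx => ->; exists 0 => k i j.
    by rewrite mulmx0 mxE Normc.normc0 mul0r.
  rewrite big_cons mulrC rmorphM /= -mulmxE -mulmxA rmorphB /= horner_mx_X.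
  rewrite horner_mx_C => /IH Y_pow.
  apply: (@geometric_powers_root _ _ _ _ _ z); first by rewrite s_ltr ?mem_head.
  by apply: Y_pow => z' z's; rewrite s_ltr ?inE ?z's ?orbT.
exists `|C|, r; split; rewrite ?normr_ge0//.
  by rewrite /r; apply/andP; split; lra.
have r_ge0 : 0 <= r by rewrite /r; lra.
move=> k; apply: mx_norm_le_entries => [|i j].
  by rewrite mulr_ge0// exprn_ge0.
have := MC_le k i j; rewrite mulmx1 -rmorphXn /= mxE /=.
rewrite /Normc.normc /= expr0n addr0 sqrtr_sqr => /le_trans -> //.
by rewrite ler_wpM2r ?exprn_ge0 ?ler_norm.
Qed.
End SchurPowers.

(** * Norms contracted by a Schur matrix *)

Section AdaptedNorm.
Context (F : realType).

Lemma mx_opnorm_le m n (M : 'M[F]_(m, n)) : mx_opnorm M <= (m * n)%:R * `|M|.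
Proof.
apply: (@le_trans _ _ (\sum_(i < m) \sum_(j < n) `|M|)).
  by do 2 (apply: ler_sum => ? _); exact: mx_entry_le_norm.
by rewrite !sumr_const !card_ord -mulrnA mulnC mulr_natl.
Qed.

Lemma schur_adapted_norm n (M : 'M[F]_n) : schur M ->
  exists (N : 'cV[F]_n -> F) r C, [/\ 0 < r < 1, 0 <= C,
    forall x y, N (x + y) <= N x + N y,
    forall x, N (M *m x) <= r * N x
  & forall x, `|x| <= N x <= C * `|x|].
Proof.
move=> /schur_geometric_powers[C0 [r0 [/andP[r00 r01] C00 M_pow]]].
pose C1 := (n * n)%:R * C0.
have Mx_pow k (x : 'cV[F]_n) : `|M ^+ k *m x| <= C1 * r0 ^+ k * `|x|.
  rewrite (le_trans (norm_mulmx _ _))// ler_wpM2r//.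
  by rewrite (le_trans (mx_opnorm_le _))// -mulrA ler_wpM2l.
pose r := (1 + r0) / 2.
have r_gt0 : 0 < r by rewrite /r; lra.
have r_lt1 : r < 1 by rewrite /r; lra.
(* Since [r0 < r], the constant [C1] is eventually beaten by [(r / r0) ^+ m]; in terms of [r0 / r]
   this also covers [r0 = 0]. *)
have [m m_gt0 Cm] : exists2 m, (0 < m)%N & C1 * r0 ^+ m <= r ^+ m.
  have rr : `|r0 / r| < 1.
    have rr0 : 0 <= r0 / r by rewrite divr_ge0// ltW.
    by rewrite (ger0_norm rr0) ltr_pdivrMr// mul1r /r; lra.
  have /cvgrPdist_lt /(_ 1 ltr01) near_lt := cvg_geometric C1 rr.
  near \oo => m; exists m; first by near: m; exact: nbhs_infty_gt.
  have : `|0 - geometric C1 (r0 / r) m| < 1 by near: m.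
  rewrite sub0r normrN /geometric /= exprMn exprVn mulrA => /ltr_normlW /ltW.
  by rewrite ler_pdivrMr ?exprn_gt0// mul1r.
pose a (x : 'cV[F]_n) k := (r ^+ k)^-1 * `|M ^+ k *m x|.
have rV k : 0 <= (r ^+ k)^-1 by rewrite invr_ge0 exprn_ge0// ltW.
have a_ge0 x k : 0 <= a x k by rewrite mulr_ge0.
have a_le x k : a x k <= (r ^+ k)^-1 * (C1 * r0 ^+ k) * `|x|.
  by rewrite -mulrA ler_wpM2l.
have a0 x : a x 0 = `|x| by rewrite /a !expr0 invr1 mul1r mul1mx.
(* A finite truncation of the weighted sum of r^-k |M^k x| is enough, because
   |M^m x| <= r^m |x|. *)
exists (fun x => \sum_(k < m) a x k), r, (\sum_(k < m) (r ^+ k)^-1 * (C1 * r0 ^+ k)).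
split=> [|||x|x].
- by rewrite r_gt0.
- by apply: sumr_ge0 => k _; rewrite !mulr_ge0// exprn_ge0.
- move=> x y; rewrite -big_split /=; apply: ler_sum => k _.
  by rewrite /a mulmxDr -mulrDr ler_wpM2l ?ler_normD.
- have -> : \sum_(k < m) a (M *m x) k = r * \sum_(k < m) a x k.+1.
    rewrite mulr_sumr; apply: eq_bigr => k _.
    rewrite /a mulmxA mulmxE -exprSr mulrA (exprS r) invfM mulrA mulfV ?mul1r//.
    by rewrite gt_eqF.
  rewrite ler_wpM2l ?(ltW r_gt0)//.
  (* Splitting the same sum at its first and at its last term compares the shifted sum with the
     original one. *)
  have : \sum_(k < m.+1) a x k = \sum_(k < m.+1) a x k by [].
  rewrite {1}big_ord_recl big_ord_recr /= a0 => Emm.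
  have : a x m <= `|x|.
    rewrite (le_trans (a_le _ _))// ler_piMl// mulrC ler_pdivrMr ?mul1r//.
    by rewrite exprn_gt0.
  by move: Emm; under eq_bigr do rewrite /bump /= add1n; lra.
- rewrite mulr_suml; apply/andP; split; last by apply: ler_sum => k _.
  case: m m_gt0 {Cm} => // m _.
  by rewrite big_ord_recl /= a0 lerDl sumr_ge0.
Unshelve. all: by end_near. Qed.

End AdaptedNorm.

(** * Square-summable sequences *)

Section SquareSummable.
Context (F : realType).
Implicit Types a b : nat -> F.

(** Bounded partial sums are equivalent to convergence here, as squares are nonnegative, and pass
    directly through inequalities. *)
Definition square_summable a := exists B, forall T, \sum_(t < T) a t ^+ 2 <= B.

Lemma square_summable_le a b : (forall t, 0 <= a t <= b t) ->
  square_summable b -> square_summable a.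
Proof.
move=> ab [B bB]; exists B => T; apply: le_trans (bB T); apply: ler_sum => t _.
by have /andP[a0 atbt] := ab t; rewrite ler_pXn2r ?nnegrE// (le_trans a0).
Qed.

Lemma square_summableD a b : square_summable a -> square_summable b ->
  square_summable (a \+ b).
Proof.
move=> [A aA] [B bB]; exists (2 * A + 2 * B) => T.
apply: (@le_trans _ _ (2 * \sum_(t < T) a t ^+ 2 + 2 * \sum_(t < T) b t ^+ 2)).
  rewrite !mulr_sumr -big_split; apply: ler_sum => t _ /=.
  by have := sqr_ge0 (a t - b t); nra.
by have := aA T; have := bB T; lra.
Qed.

Lemma square_summableZ c a : square_summable a ->
  square_summable (fun t => c * a t).
Proof.
move=> [A aA]; exists (c ^+ 2 * A) => T.
by under eq_bigr do rewrite exprMn; rewrite -mulr_sumr ler_wpM2l ?sqr_ge0.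
Qed.

Lemma square_summable_bounded a : square_summable a ->
  exists B, forall t, a t <= B.
Proof.
(* Every real [a] satisfies [a <= a ^+ 2 + 1]. *)
move=> [A aA]; exists (A + 1) => t; have := aA t.+1; rewrite big_ord_recr /=.
have : 0 <= \sum_(i < t) a i ^+ 2 by apply: sumr_ge0 => i _; exact: sqr_ge0.
by have := sqr_ge0 (a t - 1); nra.
Qed.

Lemma square_summable_cvg0 a : (forall t, 0 <= a t) -> square_summable a ->
  a @ \oo --> 0.
Proof.
move=> a_ge0 [A aA].
have : cvgn (series (fun t => a t ^+ 2)).
  apply: nondecreasing_is_cvgn.
    by apply: nondecreasing_series => t _ _; exact: sqr_ge0.
  by exists A => _ [T _ <-]; rewrite /series /= big_mkord.
move=> /(@cvg_series_cvg_0 _ F^o)/cvgrPdist_lt a2_cvg; apply/cvgrPdist_lt => e e0.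
have := a2_cvg _ (exprn_gt0 2 e0); apply: filterS => t.
by rewrite !sub0r !normrN normrX ltr_pXn2r ?nnegrE// ltW.
Qed.

(* By convexity, (r a + b)^2 <= r a^2 + b^2 / (1 - r). *)
Lemma convex_sqr_le (r x y z : F) : 0 <= r < 1 -> 0 <= z <= r * x + y ->
  z ^+ 2 <= r * x ^+ 2 + (1 - r)^-1 * y ^+ 2.
Proof.
move=> /andP[r0 r1] /andP[z0 zxy]; have r1' : 0 < 1 - r by lra.
apply: (@le_trans _ _ ((r * x + y) ^+ 2)).
  by rewrite ler_pXn2r ?nnegrE// (le_trans z0).
rewrite -subr_ge0.
have -> : r * x ^+ 2 + (1 - r)^-1 * y ^+ 2 - (r * x + y) ^+ 2
  = r / (1 - r) * ((1 - r) * x - y) ^+ 2 by field; rewrite gt_eqF.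
by rewrite mulr_ge0 ?sqr_ge0// divr_ge0// ltW.
Qed.

(** Summing [convex_sqr_le] bounds the shifted sum by [r] times the sum plus a constant; undoing the
    shift costs only [a 0 ^+ 2], and [1 - r] is divided out. *)
Lemma square_summable_forward r a b : 0 <= r < 1 -> (forall t, 0 <= a t) ->
  (forall t, a t.+1 <= r * a t + b t) -> square_summable b -> square_summable a.
Proof.
move=> r01 a_ge0 aS [B bB]; have /andP[r0 r1] := r01.
have r1' : 0 < 1 - r by lra.
exists ((a 0%N ^+ 2 + (1 - r)^-1 * B) / (1 - r)) => T; rewrite ler_pdivlMr//.
have sumS : \sum_(t < T) a t.+1 ^+ 2
    <= r * \sum_(t < T) a t ^+ 2 + (1 - r)^-1 * \sum_(t < T) b t ^+ 2.
  rewrite !mulr_sumr -big_split; apply: ler_sum => t _ /=.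
  by apply: convex_sqr_le => //; rewrite a_ge0 aS.
have : (1 - r)^-1 * \sum_(t < T) b t ^+ 2 <= (1 - r)^-1 * B.
  by rewrite ler_wpM2l ?invr_ge0 ?(ltW r1').
have : \sum_(t < T.+1) a t ^+ 2 = \sum_(t < T.+1) a t ^+ 2 by [].
rewrite {1}big_ord_recl big_ord_recr /=.
under eq_bigr do rewrite /bump /= add1n.
by have := sqr_ge0 (a T); nra.
Qed.

(** Here the boundary term is [a T ^+ 2] at the far end, hence the a priori bound [K]. *)
Lemma square_summable_backward r a b K : 0 <= r < 1 ->
  (forall t, 0 <= a t <= K) ->
  (forall t, a t <= r * a t.+1 + b t) -> square_summable b -> square_summable a.
Proof.
move=> r01 aK aS [B bB]; have /andP[r0 r1] := r01.
have r1' : 0 < 1 - r by lra.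
exists ((K ^+ 2 + (1 - r)^-1 * B) / (1 - r)) => T; rewrite ler_pdivlMr//.
have sumS : \sum_(t < T) a t ^+ 2
    <= r * \sum_(t < T) a t.+1 ^+ 2 + (1 - r)^-1 * \sum_(t < T) b t ^+ 2.
  rewrite !mulr_sumr -big_split; apply: ler_sum => t _ /=.
  by apply: convex_sqr_le => //; have /andP[-> _] := aK t; rewrite aS.
have : (1 - r)^-1 * \sum_(t < T) b t ^+ 2 <= (1 - r)^-1 * B.
  by rewrite ler_wpM2l ?invr_ge0 ?(ltW r1').
have : \sum_(t < T.+1) a t ^+ 2 = \sum_(t < T.+1) a t ^+ 2 by [].
rewrite {1}big_ord_recl big_ord_recr /=.
under eq_bigr do rewrite /bump /= add1n.
have aTK : a T ^+ 2 <= K ^+ 2.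
  by have /andP[aT0 aTK] := aK T; rewrite ler_pXn2r ?nnegrE// (le_trans aT0).
have := sqr_ge0 (a 0%N); have := sqr_ge0 (a T); nra.
Qed.

End SquareSummable.

Lemma mulmx_cvg (F : realType) m n p (M : 'M[F]_(m, n)) (f : nat -> 'M[F]_(n, p)) l :
  f @ \oo --> l -> (fun t => M *m f t) @ \oo --> M *m l.
Proof.
move=> /cvgrPdist_lt fl; apply/cvgrPdist_lt => e e0.
have M1 : 0 < mx_opnorm M + 1 by rewrite ltr_wpDl ?mx_opnorm_ge0.
have := fl _ (divr_gt0 e0 M1); apply: filterS => t.
rewrite ltr_pdivlMr// -mulmxBr; apply: le_lt_trans.
by rewrite (le_trans (norm_mulmx _ _))// mulrC ler_wpM2l// lerDl ler01.
Qed.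

(** * Anticausal recursions *)

Section AnticausalRecursion.
Context (F : realType) (n : nat) (M : 'M[F]_n).
Implicit Types g v : nat -> 'cV[F]_n.

Definition anticausal g v := forall t, v t = M *m (v t.+1 + g t).

Lemma anticausal_expand g v : anticausal g v -> forall p t,
  v t = \sum_(k < p) M ^+ k.+1 *m g (t + k)%N + M ^+ p *m v (t + p)%N.
Proof.
move=> vE; elim=> [|p IH] t; first by rewrite big_ord0 add0r expr0 mul1mx addn0.
rewrite big_ord_recr /= (IH t) -addrA; congr (_ + _).
by rewrite vE mulmxA mulmxE -exprSr mulmxDr addrC addnS.
Qed.

Hypothesis M_schur : schur M.

(** The difference solves the homogeneous recursion, along which the adapted norm never decreases in
    time; tending to zero, it vanishes throughout. *)
Lemma anticausal_unique g v v' : anticausal g v -> anticausal g v' ->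
  v @ \oo --> (0 : 'cV[F]_n) -> v' @ \oo --> (0 : 'cV[F]_n) -> v = v'.
Proof.
move=> vE v'E v0 v'0; apply/funext => t; apply/eqP; rewrite -subr_eq0.
have [N [r [C [/andP[/ltW r0 r1] C0 ND NM NC]]]] := schur_adapted_norm M_schur.
pose d t := v t - v' t.
have dE s : d s = M *m d s.+1.
  by rewrite /d vE v'E -mulmxBr opprD addrACA subrr addr0.
have N_ge0 x : 0 <= N x by have /andP[+ _] := NC x; exact: le_trans.
have Nd p : N (d t) <= N (d (t + p)%N).
  elim: p => [|p IH]; first by rewrite addn0.
  rewrite (le_trans IH)// dE (le_trans (NM _))// addnS.
  by rewrite ler_piMl// ltW.
have d0 : d @ \oo --> (0 : 'cV[F]_n) by rewrite -[0 : 'cV[F]_n](subrr 0); exact: cvgB.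
rewrite -normr_le0; apply/ler_addgt0Pr => e e0; rewrite add0r.
have C1 : 0 < C + 1 by rewrite ltr_wpDl.
move/cvgrPdist_lt: d0 => /(_ _ (divr_gt0 e0 C1)) [s _ /(_ (t + s)%N)].
rewrite /= leq_addl sub0r normrN ltr_pdivlMr// => /(_ erefl) ds.
have /andP[dN _] := NC (d t); have /andP[_ NdC] := NC (d (t + s)%N).
rewrite (le_trans dN)// (le_trans (Nd s))// (le_trans NdC)// ltW//.
by apply: le_lt_trans ds; rewrite mulrC ler_wpM2l// lerDl ler01.
Qed.

(** The solution is the series obtained by unrolling forever, dominated by a geometric one because
    [g] is bounded. Its boundedness then feeds [square_summable_backward]. *)
Lemma anticausal_exists g : square_summable (fun t => `|g t|) ->
  exists2 v, anticausal g v & square_summable (fun t => `|v t|).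
Proof.
move=> g2; have [G gG] := square_summable_bounded g2.
have [N [r [C [r01 C0 ND NM NC]]]] := schur_adapted_norm M_schur.
have /andP[r_gt0 r1] := r01; have r0 := ltW r_gt0; have r1' : 0 < 1 - r by lra.
have N_ge x : `|x| <= N x by have /andP[] := NC x.
have N_le x : N x <= C * `|x| by have /andP[] := NC x.
have N_ge0 x : 0 <= N x by exact: le_trans (N_ge x).
pose term t k := M ^+ k.+1 *m g (t + k)%N.
have NMk k x : N (M ^+ k *m x) <= r ^+ k * N x.
  elim: k => [|k IH]; first by rewrite expr0 mul1mx mul1r.
  rewrite exprS -mulmxE -mulmxA (le_trans (NM _))// exprS -mulrA.
  by rewrite ler_wpM2l.
have term_le t k : `|term t k| <= C * G * r ^+ k.
  rewrite (le_trans (N_ge _))// (le_trans (NMk _ _))// mulrC.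
  apply: (@le_trans _ _ (C * `|g (t + k)%N| * r ^+ k.+1)).
    by rewrite ler_wpM2r// exprn_ge0.
  rewrite -!mulrA ler_wpM2l// ler_pM// ?exprn_ge0//.
  by rewrite exprS ler_piMl ?exprn_ge0// ltW.
have G0 : 0 <= G by exact: le_trans (gG 0%N).
have term_cvg t : cvgn (series (term t)).
  have term_ncvg : cvgn [normed series (term t)].
    apply: (@series_le_cvg _ _ (geometric (C * G) r)) => [k|k|k|].
  - exact: normr_ge0.
  - by rewrite /geometric /= !mulr_ge0// exprn_ge0.
  - exact: term_le.
  - by apply: is_cvg_geometric_series; rewrite ger0_norm.
  move/cauchy_cvgP/cauchy_seriesP : term_ncvg => term_ncvg.
  apply/cauchy_cvgP/cauchy_seriesP => e /term_ncvg.
  apply: filterS => k /=; rewrite ger0_norm ?sumr_ge0//.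
  by apply: le_lt_trans; apply: ler_norm_sum.
pose v t := limn (series (term t)).
have vE : anticausal g v.
  (* Partial sums satisfy the recursion with an index shift: [k.+1] terms at [t] come from [k] terms
     at [t.+1]. *)
  move=> t; apply/cvg_lim; first exact: norm_hausdorff.
  rewrite -cvg_shiftS /=.
  have -> : (fun k => series (term t) k.+1)
      = (fun k => M *m (series (term t.+1) k + g t)).
    apply/funext => k; rewrite /series /= big_nat_recl// /term expr1 addn0 addrC.
    rewrite mulmxDr mulmx_sumr; congr (_ + _).
    apply: eq_bigr => j _; rewrite addnS -addSn exprS -mulmxE -mulmxA.
    by rewrite mulmxA.
  by apply: mulmx_cvg; apply: cvgD; [exact: term_cvg|exact: cvg_cst].
exists v => //.
pose K := C * G / (1 - r).
have series_le k t : `|series (term t) k| <= K.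
  rewrite /series /= (le_trans (ler_norm_sum _ _ _))//.
  apply: (@le_trans _ _ (series (geometric (C * G) r) k)).
    by apply: ler_sum => i _; exact: term_le.
  by rewrite geometric_le_lim ?mulr_ge0 ?ger0_norm.
have v_le t : `|v t| <= K + 1.
  move/cvgrPdist_lt : (term_cvg t) => /(_ 1 ltr01) [k _ /(_ k (leqnn k))] vk.
  rewrite -(subrK (series (term t) k) (v t)) (le_trans (ler_normD _ _))//.
  by rewrite addrC lerD// ltW.
apply: (@square_summable_le _ _ (fun t => N (v t))) => [t|].
  by rewrite normr_ge0 N_ge.
apply: (@square_summable_backward _ r _ (fun t => r * (C * `|g t|)) (C * (K + 1))).
- by rewrite r0.
- by move=> t; rewrite N_ge0 (le_trans (N_le _))// ler_wpM2l.
- move=> t; rewrite {1}vE (le_trans (NM _))// -mulrDr ler_wpM2l//.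
  by rewrite (le_trans (ND _ _))// lerD2l.
- by do 2 apply: square_summableZ.
Qed.

End AnticausalRecursion.

Lemma char_poly_trmx (K : comNzRingType) n (M : 'M[K]_n) : char_poly M^T = char_poly M.
Proof.
rewrite /char_poly -[RHS]det_tr; congr (\det _).
by rewrite /char_poly_mx linearB /= tr_scalar_mx map_trmx.
Qed.

(** * Forward recursions with a Schur matrix, and comparison of norms *)

Section Stable.
Context (F : realType).

Lemma schur_trmx n (M : 'M[F]_n) : schur M -> schur M^T.
Proof.
by move=> M_schur z; rewrite -map_trmx eigenvalue_root_char char_poly_trmx
  -eigenvalue_root_char => /M_schur.
Qed.

Lemma schur_square_summable n (M : 'M[F]_n) (x g : nat -> 'cV[F]_n) : schur M ->
  (forall t, x t.+1 = M *m x t + g t) ->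
  square_summable (fun t => `|g t|) -> square_summable (fun t => `|x t|).
Proof.
move=> M_schur xS g2.
have [N [r [C [/andP[/ltW r0 r1] C0 ND NM NC]]]] := schur_adapted_norm M_schur.
have N_ge y : `|y| <= N y by have /andP[] := NC y.
have N_le y : N y <= C * `|y| by have /andP[] := NC y.
have N_ge0 y : 0 <= N y by exact: le_trans (N_ge y).
apply: (@square_summable_le _ _ (fun t => N (x t))) => [t|].
  by rewrite normr_ge0 N_ge.
apply: (@square_summable_forward _ r _ (fun t => C * `|g t|)) => //.
- by rewrite r0.
- by move=> t; rewrite xS (le_trans (ND _ _))// lerD.
- exact: square_summableZ.
Qed.

(** The ball of radius [C * e / (1 - r)] for the adapted norm is invariant. The constant is chosen
    before [x], [g] and [e], which later gives uniformity in time. *)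
Lemma schur_forced_bound n (M : 'M[F]_n) : schur M -> exists2 C, 0 <= C &
  forall (x g : nat -> 'cV[F]_n) e, x 0%N = 0 ->
    (forall t, x t.+1 = M *m x t + g t) -> (forall t, `|g t| <= e) ->
    forall t, `|x t| <= C * e.
Proof.
move=> M_schur.
have [N [r [C [/andP[/ltW r0 r1] C0 ND NM NC]]]] := schur_adapted_norm M_schur.
have r1' : 0 < 1 - r by lra.
exists (C / (1 - r)); first by rewrite divr_ge0// ltW.
move=> x g e x0 xS ge t; have e0 : 0 <= e by exact: le_trans (ge 0%N).
have /andP[xN _] := NC (x t); apply: (le_trans xN).
rewrite mulrAC ler_pdivlMr//; elim: t {xN} => [|t IH].
  have /andP[_ NxC] := NC (x 0%N).
  move: NxC; rewrite x0 normr0 mulr0 => N0.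
  by have := mulr_ge0 C0 e0; nra.
have : N (x t.+1) <= r * N (x t) + C * e.
  have /andP[_ NgC] := NC (g t).
  by rewrite xS (le_trans (ND _ _))// lerD// (le_trans NgC)// ler_wpM2l.
have := mulr_ge0 C0 e0; nra.
Qed.

Lemma norm_le_norm2 n (x : 'cV[F]_n) : `|x| <= norm2 x.
Proof.
apply: mx_norm_le_entries => [|i j]; first exact: sqrtr_ge0.
rewrite (ord1 j) -sqrtr_sqr ler_wsqrtr// (bigD1 i)//= lerDl sumr_ge0// => k _.
exact: sqr_ge0.
Qed.

Lemma norm2_le_norm n (x : 'cV[F]_n) : norm2 x <= Num.sqrt n%:R * `|x|.
Proof.
rewrite /norm2 -[`|x|]ger0_norm// -sqrtr_sqr -sqrtrM// ler_wsqrtr//.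
rewrite mulr_natl -[n in _ *+ n]card_ord -sumr_const ler_sum// => i _.
by rewrite -real_normK ?num_real// ler_pXn2r ?nnegrE// mx_entry_le_norm.
Qed.

Lemma ell2_square_summable n (w : nat -> 'cV[F]_n) :
  ell2 w -> square_summable (fun t => `|w t|).
Proof.
move=> w2; apply: (@square_summable_le _ _ (fun t => norm2 (w t))) => [t|].
  by rewrite normr_ge0 norm_le_norm2.
exists (limn (series (fun t => norm2 (w t) ^+ 2))) => T.
rewrite -(big_mkord xpredT (fun t => norm2 (w t) ^+ 2)).
apply: (nondecreasing_cvgn_le _ w2); apply: nondecreasing_series => t _ _.
exact: sqr_ge0.
Qed.

Lemma square_summable_norm_cvg0 m n (x : nat -> 'M[F]_(m, n)) :
  square_summable (fun t => `|x t|) -> x @ \oo --> (0 : 'M[F]_(m, n)).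
Proof. by move=> x2; apply/norm_cvg0P; apply: square_summable_cvg0. Qed.

Lemma square_summable_mulmx m n p (M : 'M[F]_(m, n)) (x : nat -> 'M[F]_(n, p)) :
  square_summable (fun t => `|x t|) -> square_summable (fun t => `|M *m x t|).
Proof.
move=> /(square_summableZ (mx_opnorm M)); apply: square_summable_le => t.
by rewrite normr_ge0 norm_mulmx.
Qed.

Lemma square_summable_addmx m n (x y : nat -> 'M[F]_(m, n)) :
  square_summable (fun t => `|x t|) -> square_summable (fun t => `|y t|) ->
  square_summable (fun t => `|x t + y t|).
Proof.
move=> x2 y2; apply: square_summable_le (square_summableD x2 y2) => t /=.
by rewrite normr_ge0 ler_normD.
Qed.
End Stable.

(** * Quadratic forms and completion of the square *)

Section QuadraticForms.
Context (F : realType).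

Definition dot n (x y : 'cV[F]_n) : F := (x^T *m y) 0 0.

Lemma dotDl n (x x' y : 'cV[F]_n) : dot (x + x') y = dot x y + dot x' y.
Proof. by rewrite /dot linearD /= mulmxDl mxE. Qed.

Lemma dotDr n (x y y' : 'cV[F]_n) : dot x (y + y') = dot x y + dot x y'.
Proof. by rewrite /dot mulmxDr mxE. Qed.

Lemma dotNr n (x y : 'cV[F]_n) : dot x (- y) = - dot x y.
Proof. by rewrite /dot mulmxN mxE. Qed.

Lemma dotZr n c (x y : 'cV[F]_n) : dot x (c *: y) = c * dot x y.
Proof. by rewrite /dot -scalemxAr mxE. Qed.

Lemma dotC n (x y : 'cV[F]_n) : dot x y = dot y x.
Proof. by rewrite /dot -[x^T *m y]trmxK mxE trmx_mul trmxK. Qed.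

Lemma dotNl n (x y : 'cV[F]_n) : dot (- x) y = - dot x y.
Proof. by rewrite dotC dotNr dotC. Qed.

Lemma dotZl n c (x y : 'cV[F]_n) : dot (c *: x) y = c * dot x y.
Proof. by rewrite dotC dotZr dotC. Qed.

Lemma dot_mulmxl m n (M : 'M[F]_(n, m)) x y : dot (M *m x) y = dot x (M^T *m y).
Proof. by rewrite /dot trmx_mul mulmxA. Qed.

Lemma qformE n (M : 'M[F]_n) x : qform M x = dot x (M *m x).
Proof. by rewrite /qform /dot mulmxA. Qed.

Lemma dot_sym n (M : 'M[F]_n) x y : M^T = M -> dot x (M *m y) = dot y (M *m x).
Proof. by move=> M_sym; rewrite dotC dot_mulmxl M_sym. Qed.

(** The form is nonnegative along the line [x + s *: y], where it is a polynomial of degree at most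
    two in [s]. *)
Lemma psd_cauchy_schwarz n (M : 'M[F]_n) x y : psd M ->
  dot y (M *m x) ^+ 2 <= qform M y * qform M x.
Proof.
move=> [M_sym M_ge0]; set b := dot y (M *m x).
have M_line s : 0 <= qform M x + 2 * s * b + s ^+ 2 * qform M y.
  have := M_ge0 (x + s *: y); rewrite !qformE mulmxDr -scalemxAr.
  rewrite !dotDl !dotDr !dotZl !dotZr (dot_sym x y M_sym) -/b.
  by congr (0 <= _); ring.
have := M_ge0 y; rewrite le_eqVlt => /predU1P[y0|y_gt0].
  rewrite -y0 mul0r; have [->|b0] := eqVneq b 0; first by rewrite expr0n.
  (* The polynomial is affine with nonzero slope; this [s] gives it the value -1. *)
  have := M_line (- (qform M x + 1) / (2 * b)).
  rewrite -y0 mulr0 addr0 (_ : 2 * _ * b = - (qform M x + 1)); last by field.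
  by lra.
rewrite -subr_ge0.
(* The minimizing [s] is [- b / qform M y]. *)
have -> : qform M y * qform M x - b ^+ 2 = qform M y *
    (qform M x + 2 * (- b / qform M y) * b + (- b / qform M y) ^+ 2 * qform M y).
  by field; rewrite gt_eqF.
by rewrite mulr_ge0// ltW.
Qed.

(** Cauchy-Schwarz against the basis vectors bounds each entry. This turns a finite sum of forms
    into square-summability even for a singular [M]. *)
Lemma psd_mulmx_norm n (M : 'M[F]_n) x : psd M ->
  `|M *m x| ^+ 2 <= `|M| * qform M x.
Proof.
move=> M_psd; have Mx0 : 0 <= qform M x by have [] := M_psd.
have MMx0 : 0 <= `|M| * qform M x by rewrite mulr_ge0.
rewrite -(sqr_sqrtr MMx0) ler_pXn2r ?nnegrE ?sqrtr_ge0//.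
apply: mx_norm_le_entries => [|i j]; first exact: sqrtr_ge0.
rewrite -sqrtr_sqr ler_wsqrtr// (ord1 j).
have dot_delta (y : 'cV[F]_n) : dot (delta_mx i 0) y = y i 0.
  by rewrite /dot trmx_delta -rowE mxE.
rewrite -dot_delta (le_trans (psd_cauchy_schwarz _ _ M_psd))// ler_wpM2r//.
by rewrite qformE dot_delta -colE mxE (le_trans (ler_norm _))// mx_entry_le_norm.
Qed.

Lemma pd_psd n (M : 'M[F]_n) : pd M -> psd M.
Proof.
move=> [M_sym M_gt0]; split=> // x; have [->|/M_gt0/ltW//] := eqVneq x 0.
by rewrite /qform mulmx0 mxE.
Qed.

Lemma pd_unitmx n (M : 'M[F]_n) : pd M -> M \in unitmx.
Proof.
move=> [M_sym M_gt0]; rewrite -row_free_unit -kermx_eq0; apply/eqP/row_matrixP => i.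
rewrite row0; apply/eqP; apply: contraT => x0.
have : row i (kermx M) *m M = 0 by rewrite -row_mul mulmx_ker row0.
have := M_gt0 (row i (kermx M))^T; rewrite /qform trmxK.
move=> xMx xM0; move: xMx; rewrite xM0.
by rewrite mul0mx mxE ltxx => ->//; rewrite -trmx0 (inj_eq trmx_inj).
Qed.

End QuadraticForms.

Section CompletingTheSquare.
Context (F : realType) (nx nu nw : nat).
Context (A : 'M[F]_nx) (Bu : 'M[F]_(nx, nu)) (Bw : 'M[F]_(nx, nw)).
Context (Q : 'M[F]_nx) (R : 'M[F]_nu) (P : 'M[F]_nx).
Hypothesis P_stabilizing : stabilizing_dare_solution A Bu Q R P.

Local Notation H := (Hmx Bu R P).

Definition preview_input x w v : 'cV[F]_nu :=
  - (Kx A Bu R P *m x) - Kw Bu Bw R P *m w - Kv Bu R P *m v.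

Definition value x v : F := qform P x + 2 * dot v x.

(** The term d_t of the cost identity; free of [x] and [u], it cancels when two policies are
    compared. *)
Definition preview_residual w v : F :=
  let c := P *m Bw *m w + v in
  dot (Bw *m w) (P *m Bw *m w) + 2 * dot v (Bw *m w)
  - dot c (Bu *m invmx H *m Bu^T *m c).

(** The left side is quadratic in [u] with leading part [H] and minimizer [preview_input]. The
    Riccati equation matches the terms quadratic in [x], the anticausal update those linear in
    [x]. *)
Lemma completing_square x u w v :
  qform Q x + qform R u + value (A *m x + Bu *m u + Bw *m w) v
  = value x ((Ahat A Bu R P)^T *m (v + P *m Bw *m w))
    + qform H (u - preview_input x w v) + preview_residual w v.
Proof.
have [[P_sym _] H_pd dare _] := P_stabilizing.
have [H_sym _] := H_pd; have H_unit := pd_unitmx H_pd.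
set S := Bu *m invmx H *m Bu^T.
have S_sym : S^T = S by rewrite /S !trmx_mul trmxK trmx_inv H_sym mulmxA.
have dot_tr m n (M : 'M[F]_(n, m)) z z' : dot z (M^T *m z') = dot (M *m z) z'.
  by rewrite dot_mulmxl.
have dotP z z' : dot (z + z') (P *m (z + z'))
    = dot z (P *m z) + 2 * dot z (P *m z') + dot z' (P *m z').
  by rewrite mulmxDr !dotDl !dotDr (dot_sym z' z P_sym); ring.
(* Opaque names keep these vectors atomic for rewriting and for [ring]. The vector [b] equals
   [P *m y + v], half the gradient of the next value at [u = 0]. *)
have [p pE] : exists p, p = P *m (A *m x) by exists (P *m (A *m x)).
have [c cE] : exists c, c = P *m Bw *m w + v by exists (P *m Bw *m w + v).
have [b bE] : exists b, b = p + c by exists (p + c).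
have [y yE] : exists y, y = A *m x + Bw *m w by exists (A *m x + Bw *m w).
(* First-order optimality condition in [u]. *)
have Hu : H *m preview_input x w v = - (Bu^T *m b).
  rewrite /preview_input /Kx /Kw /Kv bE pE cE !mulmxDr !mulmxN !mulmxA.
  by rewrite !mulmxV// !mul1mx -!opprD addrA.
have Bu_input : Bu *m preview_input x w v = - (S *m b).
  rewrite -[preview_input x w v](mulKmx H_unit) Hu.
  by rewrite /S -!mulmxA !mulmxN.
(* The Riccati equation, solved for [Q]. *)
have Qx : Q *m x = P *m x - A^T *m p + A^T *m (P *m (S *m p)).
  have -> : Q = P - A^T *m P *m A + A^T *m P *m S *m P *m A.
    apply/eqP; rewrite -subr_eq0 -oppr_eq0 /S !mulmxA {1}dare.
    by rewrite opprB addrAC.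
  by rewrite pE mulmxDl mulmxBl !mulmxA.
have Ru : R *m u = H *m u - Bu^T *m (P *m (Bu *m u)).
  by rewrite /Hmx mulmxDl !mulmxA addrK.
have AhatE : Ahat A Bu R P *m x = A *m x - S *m p.
  by rewrite /Ahat /Kx pE mulmxBl /S !mulmxA.
move: (preview_input x w v) Hu Bu_input => us Hu Bu_us.
have x_Qx : dot x (Q *m x) = dot x (P *m x) - dot (A *m x) p + dot p (S *m p).
  by rewrite Qx !dotDr dotNr !dot_tr -[P in P *m (S *m p)]P_sym dot_tr -pE.
have u_Ru : dot u (R *m u) = dot u (H *m u) - dot (Bu *m u) (P *m (Bu *m u)).
  by rewrite Ru dotDr dotNr dot_tr.
have v_x : dot ((Ahat A Bu R P)^T *m (v + P *m Bw *m w)) x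
    = dot (A *m x) (P *m (Bw *m w)) + dot v (A *m x) - dot c (S *m p).
  rewrite dotC dot_tr AhatE (addrC v) -cE dotDl dotNl (dotC (S *m p)).
  by rewrite {1}cE dotDr -mulmxA (dotC v).
have e_He : dot (u - us) (H *m (u - us))
    = dot u (H *m u) + 2 * dot (Bu *m u) b + dot b (S *m b).
  rewrite mulmxBr Hu opprK !dotDr !dotDl !dotNl (dot_sym us u H_sym) Hu.
  by rewrite dotNr !dot_tr Bu_us dotNl (dotC (S *m b)); ring.
have b_Sb : dot b (S *m b)
    = dot p (S *m p) + 2 * dot c (S *m p) + dot c (S *m c).
  by rewrite bE mulmxDr !dotDl !dotDr (dot_sym p c S_sym); ring.
have Pyv : P *m y + v = b.
  by rewrite bE cE yE pE mulmxDr addrA -[P *m Bw *m w]mulmxA.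
have u_b : dot (Bu *m u) b = dot (Bu *m u) (P *m y) + dot v (Bu *m u).
  by rewrite -Pyv dotDr (dotC v).
rewrite /value /preview_residual !qformE -/S -cE (addrAC (A *m x)) -yE dotP e_He b_Sb u_b.
rewrite v_x x_Qx u_Ru (dot_sym y (Bu *m u) P_sym) dotDr.
have -> : dot y (P *m y) = dot (A *m x) p + 2 * dot (A *m x) (P *m (Bw *m w))
    + dot (Bw *m w) (P *m (Bw *m w)) by rewrite yE dotP pE.
have -> : dot v y = dot v (A *m x) + dot v (Bw *m w) by rewrite yE dotDr.
by rewrite -mulmxA; ring.
Qed.

End CompletingTheSquare.

(** * Bounds for quadratic forms along sequences *)

Section Bounds.
Context (F : realType).

Lemma dot_le n (x y : 'cV[F]_n) : `|dot x y| <= n%:R * (`|x| * `|y|).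
Proof.
rewrite /dot mxE (le_trans (ler_norm_sum _ _ _))//.
rewrite mulr_natl -[n in _ *+ n]card_ord -sumr_const ler_sum// => i _.
by rewrite mxE normrM ler_pM// mx_entry_le_norm.
Qed.

Lemma qform_le n (M : 'M[F]_n) x :
  `|qform M x| <= n%:R * mx_opnorm M * `|x| ^+ 2.
Proof.
rewrite qformE (le_trans (dot_le _ _))// -mulrA ler_wpM2l// expr2 mulrCA.
by rewrite ler_wpM2l// norm_mulmx.
Qed.

Lemma value_cvg0 n (P : 'M[F]_n) (x v : nat -> 'cV[F]_n) :
  square_summable (fun t => `|x t|) -> square_summable (fun t => `|v t|) ->
  (fun t => value P (x t) (v t)) @ \oo --> (0 : F).
Proof.
move=> /(square_summable_cvg0 (fun=> normr_ge0 _)) x0.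
move=> /(square_summable_cvg0 (fun=> normr_ge0 _)) v0.
pose b t := n%:R * mx_opnorm P * (`|x t| * `|x t|) + 2 * n%:R * (`|v t| * `|x t|).
have b0 : b @ \oo --> (0 : F).
  rewrite [X in _ --> X](_ : _ = n%:R * mx_opnorm P * (0 * 0) + 2 * n%:R * (0 * 0)).
    apply: cvgD; (apply: cvgM; first exact: cvg_cst); exact: cvgM.
  by rewrite !mulr0 addr0.
apply/norm_cvg0P; apply: (squeeze_cvgr _ (cvg_cst 0) b0).
apply: nearW => t; rewrite normr_ge0 /value (le_trans (ler_normD _ _))//.
rewrite lerD// ?(le_trans (qform_le _ _))// normrM ger0_norm// -mulrA ler_wpM2l//.
exact: dot_le.
Qed.

Lemma square_summable_shift (a : nat -> F) :
  square_summable a -> square_summable (fun t => a t.+1).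
Proof.
move=> [B aB]; exists B => T; apply: le_trans (aB T.+1).
by rewrite big_ord_recl lerDr sqr_ge0.
Qed.

Lemma qform_sum_bounded n (N : 'M[F]_n) (z : nat -> 'cV[F]_n) :
  square_summable (fun t => `|z t|) ->
  exists B, forall T, \sum_(t < T) qform N (z t) <= B.
Proof.
move=> [B zB]; exists (n%:R * mx_opnorm N * B) => T.
apply: (@le_trans _ _ (n%:R * mx_opnorm N * \sum_(t < T) `|z t| ^+ 2)).
  by rewrite mulr_sumr ler_sum// => t _; rewrite (le_trans (ler_norm _))// qform_le.
by rewrite ler_wpM2l// mulr_ge0// mx_opnorm_ge0.
Qed.

Lemma psd_square_summable n (N : 'M[F]_n) (z : nat -> 'cV[F]_n) B : psd N ->
  (forall T, \sum_(t < T) qform N (z t) <= B) ->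
  square_summable (fun t => `|N *m z t|).
Proof.
move=> N_psd zB; exists (`|N| * B) => T.
apply: (@le_trans _ _ (`|N| * \sum_(t < T) qform N (z t))).
  by rewrite mulr_sumr ler_sum// => t _; exact: psd_mulmx_norm.
by rewrite ler_wpM2l.
Qed.

End Bounds.

(** * The closed loop *)

Section Plant.
Context (F : realType) (nx nu nw : nat).
Context (A : 'M[F]_nx) (Bu : 'M[F]_(nx, nu)) (Bw : 'M[F]_(nx, nw)).

Lemma stateS (k : policy F nx nu nw) w x0 t :
  state A Bu Bw k w x0 t.+1 = A *m state A Bu Bw k w x0 t
    + Bu *m command A Bu Bw k w x0 t + Bw *m w t.
Proof.
by rewrite {1}/state /= (tnth_nth 0) /= nth_rcons size_tuple ltnn eqxx.
Qed.

Context (Q : 'M[F]_nx) (R : 'M[F]_nu) (P : 'M[F]_nx).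

Lemma preview_closed_loop x w v :
  A *m x + Bu *m preview_input A Bu Bw R P x w v + Bw *m w
  = Ahat A Bu R P *m x
    + (Bw *m w - Bu *m (Kw Bu Bw R P *m w) - Bu *m (Kv Bu R P *m v)).
Proof.
rewrite /preview_input /Ahat mulmxBl !mulmxDr !mulmxN -!mulmxA -!addrA.
by congr (_ + (_ + _)); rewrite addrA addrC.
Qed.

Lemma preview_inputB x x' w v v' :
  preview_input A Bu Bw R P x w v - preview_input A Bu Bw R P x' w v'
  = - (Kx A Bu R P *m (x - x')) - Kv Bu R P *m (v - v').
Proof.
rewrite /preview_input !mulmxBr !opprD !opprK addrACA; congr (_ + _).
by rewrite addrACA addNr addr0.
Qed.

Definition stage_cost (k : policy F nx nu nw) w x0 t :=
  qform Q (state A Bu Bw k w x0 t) + qform R (command A Bu Bw k w x0 t).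

Hypotheses (Q_psd : psd Q) (R_pd : pd R).

Lemma stage_cost_ge0 k w x0 t : 0 <= stage_cost k w x0 t.
Proof.
by apply: addr_ge0; [case: Q_psd|have [_] := pd_psd R_pd]; exact.
Qed.

(** Nonnegative stage costs reduce the extended-real series to its partial sums, so that comparisons
    of costs take place in [F]. *)
Lemma cost_leP k w x0 B : (cost A Bu Bw Q R k w x0 <= B%:E)%E <->
  forall T, \sum_(t < T) stage_cost k w x0 t <= B.
Proof.
have stage_ge0 t : (0 <= (stage_cost k w x0 t)%:E)%E.
  by rewrite lee_fin stage_cost_ge0.
split=> [cost_le T|sum_le].
  rewrite -lee_fin; apply: le_trans cost_le.
  rewrite -sumEFin -(big_mkord xpredT (fun t => (stage_cost k w x0 t)%:E)).
  by apply: nneseries_lim_ge => t _ _; exact: stage_ge0.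
apply: lime_le; first by apply: is_cvg_nneseries => t _ _; exact: stage_ge0.
by apply: nearW => T; rewrite big_mkord sumEFin lee_fin sum_le.
Qed.

Hypothesis P_stabilizing : stabilizing_dare_solution A Bu Q R P.
Hypothesis AQ_detectable : detectable A Q.

Lemma anticausal_solution_unique w v v' :
  anticausal_solution A Bu Bw R P w v -> anticausal_solution A Bu Bw R P w v' ->
  v = v'.
Proof.
have [_ _ _ /schur_trmx Ahat_schur] := P_stabilizing.
move=> [vE v0] [v'E v'0].
exact: (anticausal_unique Ahat_schur vE v'E v0 v'0).
Qed.

Variable w : nat -> 'cV[F]_nw.
Hypothesis w_ell2 : ell2 w.

Local Notation v := (vnc A Bu Bw R P w).
Local Notation unc := (noncausal_policy A Bu Bw R P).
Local Notation up := (finite_preview_policy A Bu Bw R P).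
Local Notation M := (Ahat A Bu R P)^T.

(** Existence rules out the default value of [vnc]; uniqueness transfers square-summability from the
    constructed solution. *)
Lemma vncP : anticausal_solution A Bu Bw R P w v /\
  square_summable (fun t => `|v t|).
Proof.
have [_ _ _ /schur_trmx Ahat_schur] := P_stabilizing.
have [v' v'E v'2] := anticausal_exists Ahat_schur
  (square_summable_mulmx (P *m Bw) (ell2_square_summable w_ell2)).
have v'_sol : anticausal_solution A Bu Bw R P w v'.
  by split; [exact: v'E|exact: square_summable_norm_cvg0].
have v_sol : anticausal_solution A Bu Bw R P w v.
  by rewrite /vnc; apply: xgetPex; exists v'.
by split=> //; rewrite (anticausal_solution_unique v_sol v'_sol).
Qed.

Lemma preview_remainder p t :
  v t.+1 - \sum_(t.+1 <= j < (t + p).+1) preview_term A Bu Bw R P w t j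
  = M ^+ p *m v (t.+1 + p)%N.
Proof.
have [[vE _] _] := vncP; rewrite (anticausal_expand vE p).
rewrite -addSn -{3}[t.+1]add0n big_addn addKn big_mkord.
(* With [j = k + t.+1] the exponent [j - t] is [k.+1], as in [anticausal_expand]. *)
rewrite (eq_bigr (fun k : 'I_p => preview_term A Bu Bw R P w t (k + t.+1))).
  by rewrite addrAC subrr add0r.
by move=> k _; rewrite /preview_term addnS subSn ?leq_addl// addnK addSn addnC !mulmxA.
Qed.

Lemma preview_error_cvg0 e : 0 < e -> \forall p \near \oo, forall t,
  `|v t.+1 - \sum_(t.+1 <= j < (t + p).+1) preview_term A Bu Bw R P w t j| < e.
Proof.
have [_ _ _ /schur_trmx/schur_geometric_powers[C [r [/andP[r0 r1] C0 M_pow]]]] :=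
  P_stabilizing.
have [_ /square_summable_bounded[B vB]] := vncP.
have B0 : 0 <= B by exact: le_trans (vB 0%N).
pose K := (nx * nx)%:R * C * B.
have r1' : `|r| < 1 by rewrite ger0_norm.
move=> e0; have /cvgrPdist_lt/(_ e e0) := cvg_geometric K r1'.
apply: filterS => p; rewrite sub0r normrN => /ltr_normlW Kr t.
rewrite preview_remainder (le_lt_trans _ Kr)// (le_trans (norm_mulmx _ _))//.
rewrite /geometric /K /= mulrAC ler_pM ?mx_opnorm_ge0//.
by rewrite (le_trans (mx_opnorm_le _))// -mulrA ler_wpM2l.
Qed.

Lemma preview_series_cvg t :
  \sum_(t.+1 <= j < n) preview_term A Bu Bw R P w t j @[n --> \oo] --> v t.+1.
Proof.
apply/cvgrPdist_lt => e /preview_error_cvg0[N _ Ne].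
exists (N + t.+1)%N => // n /= Nn.
(* The partial sum up to [n] is a finite preview of [n - t.+1] steps. *)
have [p Np ->] : exists2 p, (N <= p)%N & n = (t + p).+1.
  exists (n - t.+1)%N; first by rewrite -(leq_add2r t.+1) subnK// (leq_trans _ Nn)// leq_addl.
  by rewrite -addSn subnKC// (leq_trans _ Nn)// leq_addl.
exact: Ne.
Qed.

(** * Command error and optimality from a fixed initial state *)

Section ClosedLoop.
Variable x0 : 'cV[F]_nx.
Local Notation x k := (state A Bu Bw k w x0).
Local Notation u k := (command A Bu Bw k w x0).

Lemma command_error_cvg0 e : 0 < e -> \forall p \near \oo, forall t,
  norm2 (u unc t - u (up p) t) < e.
Proof.
have [_ _ _ /schur_forced_bound[C C0 Ahat_bound]] := P_stabilizing.
pose BK := mx_opnorm (Bu *m Kv Bu R P).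
(* Total gain from preview error to command error: through the state deviation and [Kx], and
   directly through [Kv]. Dividing by [D + 1] avoids a zero divisor and keeps the final bound
   strict. *)
pose D := Num.sqrt nu%:R
  * (mx_opnorm (Kx A Bu R P) * (C * BK) + mx_opnorm (Kv Bu R P)).
have D1 : 0 < D + 1.
  by rewrite ltr_wpDl// mulr_ge0// addr_ge0// ?mulr_ge0// mx_opnorm_ge0.
move=> e0; have eD := divr_gt0 e0 D1.
have := preview_error_cvg0 eD; apply: filterS => p err t.
pose d s := v s.+1 - \sum_(s.+1 <= j < (s + p).+1) preview_term A Bu Bw R P w s j.
have d_le s : `|d s| <= e / (D + 1) by exact/ltW/err.
have x_le s : `|x unc s - x (up p) s| <= C * (BK * (e / (D + 1))).
  apply: (Ahat_bound (fun s => x unc s - x (up p) s)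
    (fun s => - (Bu *m Kv Bu R P *m d s))) => [|{}s|{}s].
  - by rewrite /state /= subrr.
  - rewrite !stateS /command !preview_closed_loop opprD addrACA -mulmxBr.
    congr (_ + _); rewrite opprD addrACA subrr add0r -opprD -mulmxBr -mulmxBr.
    by rewrite mulmxA.
  - by rewrite normrN (le_trans (norm_mulmx _ _))// ler_wpM2l// mx_opnorm_ge0.
have -> : u unc t - u (up p) t
    = - (Kx A Bu R P *m (x unc t - x (up p) t)) - Kv Bu R P *m d t.
  exact: (preview_inputB (x unc t) (x (up p) t) (w t) (v t.+1) _).
apply: (le_lt_trans (norm2_le_norm _)).
have : Num.sqrt nu%:R * `|- (Kx A Bu R P *m (x unc t - x (up p) t)) - Kv Bu R P *m d t|
    <= D * (e / (D + 1)).
  rewrite /D -mulrA ler_wpM2l ?sqrtr_ge0// (le_trans (ler_normB _ _))// normrN mulrDl.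
  rewrite lerD// (le_trans (norm_mulmx _ _))//; last first.
    by rewrite ler_wpM2l// mx_opnorm_ge0.
  by rewrite -!mulrA ler_wpM2l// mx_opnorm_ge0.
move=> /le_lt_trans; apply; rewrite mulrCA gtr_pMr// ltr_pdivrMr// mul1r.
by rewrite ltrDl.
Qed.

Lemma noncausal_state_square_summable : square_summable (fun t => `|x unc t|).
Proof.
have [_ _ _ Ahat_schur] := P_stabilizing; have [_ v2] := vncP.
have w2 := ell2_square_summable w_ell2.
apply: (schur_square_summable Ahat_schur
  (g := fun t => (Bw - Bu *m Kw Bu Bw R P) *m w t + - (Bu *m Kv Bu R P) *m v t.+1)).
  move=> t; rewrite stateS /command preview_closed_loop.
  by congr (_ + _); rewrite mulmxBl mulNmx; congr (_ - _ - _); rewrite mulmxA.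
apply: square_summable_addmx; first exact: square_summable_mulmx.
apply: (square_summable_mulmx _ (x := fun t => v t.+1)).
exact: square_summable_shift v2.
Qed.

Lemma noncausal_command_square_summable : square_summable (fun t => `|u unc t|).
Proof.
have [_ v2] := vncP; have w2 := ell2_square_summable w_ell2.
have x2 := noncausal_state_square_summable.
rewrite (_ : (fun t => _) = (fun t => `|(- Kx A Bu R P *m x unc t
    + - Kw Bu Bw R P *m w t) + - Kv Bu R P *m v t.+1|)); last first.
  by apply/funext => t; rewrite !mulNmx.
apply: square_summable_addmx.
  by apply: square_summable_addmx; exact: square_summable_mulmx.
apply: (square_summable_mulmx _ (x := fun t => v t.+1)).
exact: square_summable_shift v2.
Qed.

Lemma noncausal_cost_finite : exists B, (cost A Bu Bw Q R unc w x0 <= B%:E)%E.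
Proof.
have [Bx xB] := qform_sum_bounded Q noncausal_state_square_summable.
have [Bu' uB] := qform_sum_bounded R noncausal_command_square_summable.
by exists (Bx + Bu'); apply/cost_leP => T; rewrite big_split lerD.
Qed.

Lemma finite_cost_state_square_summable k B :
  (cost A Bu Bw Q R k w x0 <= B%:E)%E -> square_summable (fun t => `|x k t|).
Proof.
move=> /cost_leP kB; have [L AL_schur] := AQ_detectable.
have R_psd := pd_psd R_pd; have [_ Q_ge0] := Q_psd; have [_ R_ge0] := R_psd.
have Qx2 : square_summable (fun t => `|Q *m x k t|).
  apply: (psd_square_summable (B := B)) => // T; apply: le_trans (kB T).
  by apply: ler_sum => t _; rewrite lerDl.
have Ru2 : square_summable (fun t => `|R *m u k t|).
  apply: (psd_square_summable (B := B)) => // T; apply: le_trans (kB T).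
  by apply: ler_sum => t _; rewrite lerDr.
have u2 : square_summable (fun t => `|u k t|).
  have := square_summable_mulmx (invmx R) Ru2.
  by under eq_fun do rewrite mulKmx ?pd_unitmx//.
(* Output injection: the trajectory obeys [A - L *m Q], driven by the square-summable [Q *m x], [u]
   and [w]. *)
apply: (schur_square_summable AL_schur
  (g := fun t => L *m (Q *m x k t) + Bu *m u k t + Bw *m w t)).
  by move=> t; rewrite stateS mulmxBl -mulmxA -addrA [in RHS]addrA !addrA subrK.
by do 2 ?apply: square_summable_addmx; apply: square_summable_mulmx => //;
  exact: ell2_square_summable.
Qed.

Definition input_excess k t : F :=
  qform (Hmx Bu R P) (u k t - preview_input A Bu Bw R P (x k t) (w t) (v t.+1)).

Lemma input_excess_ge0 k t : 0 <= input_excess k t.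
Proof. by have [_ /pd_psd[_ +] _ _] := P_stabilizing; exact. Qed.

(** The anticausal dynamics turn the first term on the right of [completing_square] into the value
    at time [t], so the one-step identities telescope. *)
Lemma cost_telescope k T :
  \sum_(t < T) stage_cost k w x0 t + value P (x k T) (v T)
  = value P x0 (v 0%N) + \sum_(t < T) input_excess k t
    + \sum_(t < T) preview_residual Bu Bw R P (w t) (v t.+1).
Proof.
have [[vE _] _] := vncP.
elim: T => [|T IH]; first by rewrite !big_ord0 add0r !addr0.
rewrite !big_ord_recr /= stateS.
have := completing_square Bw P_stabilizing (x k T) (u k T) (w T) (v T.+1).
rewrite -vE -/(input_excess k T) -/(stage_cost k w x0 T) => step.
by move: step IH; lra.
Qed.

Lemma noncausal_input_excess t : input_excess unc t = 0.
Proof. by rewrite /input_excess subrr /qform mulmx0 mxE. Qed.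

(** Keeping one excess term serves twice: dropping it gives optimality, and equality of costs forces
    it to vanish. *)
Lemma noncausal_cost_le k B s : (cost A Bu Bw Q R k w x0 <= B%:E)%E ->
  (cost A Bu Bw Q R unc w x0 <= (B - input_excess k s)%:E)%E.
Proof.
move=> kB; have x2 := finite_cost_state_square_summable kB.
move/cost_leP in kB; apply/cost_leP => T.
have [_ v2] := vncP; have xn2 := noncausal_state_square_summable.
have dV0 : (fun t => value P (x k t) (v t) - value P (x unc t) (v t)) @ \oo --> (0 : F).
  by rewrite -[0 : F](subrr 0); apply: cvgB; exact: value_cvg0.
move/cvgrPdist_lt in dV0; apply/ler_addgt0Pr => e /dV0[N _ /= Ne].
(* A horizon beyond [T], beyond the retained index [s], and late enough for the boundary values to
   differ by less than [e]. *)
pose T' := (maxn (maxn T s.+1) N).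
have TT' : (T <= T')%N by rewrite /T' -maxnA leq_maxl.
have sT' : (s < T')%N by rewrite /T' (maxnC T) -maxnA leq_maxl.
have := Ne T' (leq_maxr _ _); rewrite sub0r normrN => /ltr_normlW dV.
have sum_mono : \sum_(t < T) stage_cost unc w x0 t <= \sum_(t < T') stage_cost unc w x0 t.
  rewrite -!(big_mkord xpredT (stage_cost unc w x0)) (@big_cat_nat _ _ _ T 0 T')//= lerDl.
  by apply: sumr_ge0 => t _; exact: stage_cost_ge0.
have excess_s : input_excess k s <= \sum_(t < T') input_excess k t.
  rewrite (bigD1 (Ordinal sT'))//= lerDl; apply: sumr_ge0 => t _.
  exact: input_excess_ge0.
have := cost_telescope k T'; have := cost_telescope unc T'.
have -> : \sum_(t < T') input_excess unc t = 0.
  by apply: big1 => t _; exact: noncausal_input_excess.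
have := kB T'; move: dV sum_mono excess_s; lra.
Qed.

End ClosedLoop.

End Plant.

Theorem theorem5 (F : realType) (nx nu nw : nat)
    (A : 'M[F]_nx) (Bu : 'M[F]_(nx, nu)) (Bw : 'M[F]_(nx, nw))
    (Q : 'M[F]_nx) (R : 'M[F]_nu) (P : 'M[F]_nx) (w : nat -> 'cV[F]_nw)
    (A_nonsingular : A \in unitmx)
    (ABu_stabilizable : stabilizable A Bu)
    (Q_psd : psd Q) (R_pd : pd R)
    (AQ_detectable : detectable A Q)
    (P_stabilizing : stabilizing_dare_solution A Bu Q R P)
    (w_ell2 : ell2 w) :
  let unc := noncausal_policy A Bu Bw R P in
  let up := finite_preview_policy A Bu Bw R P in
  [/\ (* the noncausal policy is optimal, and the only optimal one as far as
         the generated commands are concerned *)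
      noncausal_optimal A Bu Bw Q R w unc /\
      (forall k : policy F nx nu nw, noncausal_optimal A Bu Bw Q R w k ->
         forall x0 t, command A Bu Bw k w x0 t = command A Bu Bw unc w x0 t),
      (* v^nc is the unique solution of the anticausal dynamics *)
      unique (anticausal_solution A Bu Bw R P w) (vnc A Bu Bw R P w),
      (* its series expression *)
      forall t,
        \sum_(t.+1 <= j < n) preview_term A Bu Bw R P w t j @[n --> \oo]
          --> vnc A Bu Bw R P w t.+1
    & (* uniform convergence of the finite preview commands *)
      forall (x0 : 'cV[F]_nx) (e : F), 0 < e ->
        \forall p \near \oo, forall t,
          norm2 (command A Bu Bw unc w x0 t
                 - command A Bu Bw (up p) w x0 t) < e].
Proof.
move=> unc up.
have [v_sol v2] := vncP Bw P_stabilizing w_ell2.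
have unc_le := noncausal_cost_le Q_psd R_pd P_stabilizing AQ_detectable w_ell2.
have unc_stab : stabilizing A Bu Bw unc w.
  move=> x0; have /square_summable_bounded[B xB] :=
    noncausal_state_square_summable Bw P_stabilizing w_ell2 x0.
  exists (Num.sqrt nx%:R * B) => t; rewrite (le_trans (norm2_le_norm _))//.
  by rewrite ler_wpM2l ?sqrtr_ge0.
split; [split; [split=> // k _ x0|move=> k [_ k_opt] x0]| | |].
- case k_cost: (cost A Bu Bw Q R k w x0) => [c| |]; last 2 first.
  + by rewrite leey.
  (* The empty partial sum already excludes the cost [-oo]. *)
  + have /(cost_leP A Bu Bw Q_psd R_pd)/(_ 0%N) :
      (cost A Bu Bw Q R k w x0 <= (-1)%:E)%E by rewrite k_cost leNye.
    by rewrite big_ord0 oppr_ge0 ler10.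
  have := unc_le Bw x0 k c 0%N; rewrite k_cost lexx => /(_ isT)/le_trans; apply.
  by rewrite lee_fin gerBl (input_excess_ge0 Bw P_stabilizing).
- have [B unc_B] := noncausal_cost_finite Bw Q_psd R_pd P_stabilizing w_ell2 x0.
  have [c c_def] : exists c, cost A Bu Bw Q R unc w x0 = c%:E.
    case unc_cost: (cost A Bu Bw Q R unc w x0) => [c| |]; first by exists c.
      by move: unc_B; rewrite unc_cost leye_eq.
    have /(cost_leP A Bu Bw Q_psd R_pd)/(_ 0%N) :
      (cost A Bu Bw Q R unc w x0 <= (-1)%:E)%E by rewrite unc_cost leNye.
    by rewrite big_ord0 oppr_ge0 ler10.
  (* Both costs equal the finite [c], so each excess is nonpositive, and definiteness of [H] makes
     [k] apply the feedback law along its own trajectory. *)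
  have k_input s : command A Bu Bw k w x0 s = preview_input A Bu Bw R P
      (state A Bu Bw k w x0 s) (w s) (vnc A Bu Bw R P w s.+1).
    have := unc_le Bw x0 k c s; rewrite -{1}c_def => /(_ (k_opt _ unc_stab x0)).
    rewrite c_def lee_fin lerBrDr gerDl => excess_le0; apply/eqP.
    rewrite -subr_eq0; apply: contraTT excess_le0 => neq0.
    by have [_ [_ H_pos] _ _] := P_stabilizing; rewrite -ltNge H_pos.
  have k_state s : state A Bu Bw k w x0 s = state A Bu Bw unc w x0 s.
    by elim: s => [|s IH] //; rewrite !stateS k_input IH.
  by move=> t; rewrite k_input k_state.
- by split=> // v' v'_sol; exact: (anticausal_solution_unique P_stabilizing v_sol v'_sol).
- exact: (preview_series_cvg P_stabilizing w_ell2).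
- move=> x0 e e0; exact: (command_error_cvg0 Bw P_stabilizing w_ell2 x0 e0).
Qed.
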